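(* Let $d \geq 1$ and let $\Sigma$ be a $d \times d$ positive semidefinite matrix with $\operatorname{Tr}(\Sigma) = 1$. Let $f(\boldsymbol{z}) = \boldsymbol{w}^T\boldsymbol{z} + \boldsymbol{b}$ be a binary linear classifier with $\boldsymbol{w} \in \mathbb{R}^d\setminus\{\boldsymbol{0}\}$, $\boldsymbol{b} \in \mathbb{R}$, and let $\boldsymbol{x} \in \mathbb{R}^d$ with $f(\boldsymbol{x}) \neq 0$. Then for every $0 < \varepsilon < \frac{1}{3}$, \[ \sqrt{\frac{1}{2\ln(1/\varepsilon)}}\;\frac{\|\boldsymbol{w}\|_2}{\|\sqrt{\Sigma}\boldsymbol{w}\|_2} \leq \frac{r_{\Sigma,\varepsilon}(\boldsymbol{x})}{\|\boldsymbol{r}^*_2(\boldsymbol{x})\|_2} \leq \sqrt{\frac{1}{1 - \sqrt{3\varepsilon}}}\;\frac{\|\boldsymbol{w}\|_2}{\|\sqrt{\Sigma}\boldsymbol{w}\|_2}. \]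
   Context: The predicted label is $g(\boldsymbol{z}) = 1$ if $f(\boldsymbol{z}) > 0$ and $g(\boldsymbol{z}) = 0$ otherwise. $\sqrt{\Sigma}$ is the symmetric positive semidefinite square root of $\Sigma$. Let $\boldsymbol{v} \sim \mathcal{N}(\boldsymbol{0}, \Sigma)$. For $\varepsilon > 0$, $r_{\Sigma,\varepsilon}(\boldsymbol{x}) = \inf\{|\alpha| : \alpha\in\mathbb{R},\ \mathbb{P}_{\boldsymbol{v}}\{g(\boldsymbol{x}+\alpha\boldsymbol{v}) \neq g(\boldsymbol{x})\} \geq \varepsilon\}$, with $\inf\emptyset = +\infty$. Also $\|\boldsymbol{r}^*_2(\boldsymbol{x})\|_2 = \inf\{\|\boldsymbol{r}\|_2 : g(\boldsymbol{x}+\boldsymbol{r}) \neq g(\boldsymbol{x})\}$, the Euclidean distance from $\boldsymbol{x}$ to the decision boundary. A fraction with zero denominator is read as $+\infty$. *)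

(* Defs.v *)
From HB Require Import structures.
From mathcomp Require Import all_boot all_order all_algebra.
From mathcomp Require Import all_classical all_reals all_analysis.
Set Implicit Arguments. Unset Strict Implicit. Unset Printing Implicit Defensive.
Import Order.TTheory GRing.Theory Num.Theory.
Local Open Scope classical_set_scope.
Local Open Scope ring_scope.

Section Defs.
Variable R : realType.

Definition norm2 (d : nat) (u : 'cV[R]_d) : R :=
  Num.sqrt (\sum_(i < d) u i 0 ^+ 2).

Definition linf (d : nat) (w : 'cV[R]_d) (b : R) (z : 'cV[R]_d) : R :=
  (w^T *m z) 0 0 + b.

Definition label (d : nat) (w : 'cV[R]_d) (b : R) (z : 'cV[R]_d) : nat :=
  if 0 < linf w b z then 1%N else 0%N.

Definition psd (d : nat) (M : 'M[R]_d) : Prop :=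
  M^T = M /\ forall u : 'cV[R]_d, 0 <= (u^T *m M *m u) 0 0.

Definition efrac (a b : \bar R) : \bar R :=
  if b == 0%E then +oo%E else (a / b)%E.

(* ||r*_2(x)||_2 = inf { ||r||_2 : g(x + r) <> g(x) }  (inf of empty = +oo) *)
Definition dist_boundary (d : nat) (w : 'cV[R]_d) (b : R) (x : 'cV[R]_d)
  : \bar R :=
  ereal_inf [set (norm2 r)%:E | r in [set r | label w b (x + r) != label w b x]].

Definition mutually_independent (d0 : measure_display) (T : measurableType d0)
  (P : probability T R) (d : nat) (Z : 'I_d -> {RV P >-> R}) : Prop :=
  forall B : 'I_d -> set R, (forall i, measurable (B i)) ->
    P [set om | forall i, B i (Z i om)] = (\prod_(i < d) P (Z i @^-1` B i))%E.

Definition std_normal_family (d0 : measure_display) (T : measurableType d0)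
  (P : probability T R) (d : nat) (Z : 'I_d -> {RV P >-> R}) : Prop :=
  forall i (A : set R), measurable A -> P (Z i @^-1` A) = normal_prob 0 1 A.

(* v = sqrt(Sigma) Z, a N(0, Sigma) random vector when Z is standard Gaussian *)
Definition gauss_vec (d0 : measure_display) (T : measurableType d0)
  (P : probability T R) (d : nat) (S : 'M[R]_d) (Z : 'I_d -> {RV P >-> R})
  (om : T) : 'cV[R]_d :=
  S *m \col_i Z i om.

Definition r_sigma (d0 : measure_display) (T : measurableType d0)
  (P : probability T R) (d : nat) (S : 'M[R]_d) (Z : 'I_d -> {RV P >-> R})
  (w : 'cV[R]_d) (b : R) (eps : R) (x : 'cV[R]_d) : \bar R :=
  ereal_inf [set `|a|%:E | a in
    [set a : R | (eps%:E <= P [set om | label w b (x + a *: gauss_vec S Z om)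
                                        != label w b x])%E]].

End Defs.

(* Main.v *)
Require Import Defs.
From HB Require Import structures.
From mathcomp Require Import all_boot all_order all_algebra.
From mathcomp Require Import all_classical all_reals all_analysis.
From mathcomp Require Import measurable_realfun ring lra.
Set Implicit Arguments.
Unset Strict Implicit.
Unset Printing Implicit Defensive.
Import Order.TTheory GRing.Theory Num.Theory.
Local Open Scope classical_set_scope.
Local Open Scope ring_scope.

(** Only the scalar [w^T v] matters: it is a centered Gaussian of standard
    deviation [s = norm2 (S *m w)], so moving by [a *: v] flips the label with
    the probability that [`|a| * s * z] exceeds [`|f x|] for [z] of law N(0, 1).
    The lower bound is the tail estimate [exp (- t ^ 2 / 2)]; the upper bound uses
    [P (z > t) >= (1 - t) / 2 >= (1 - t ^ 2) ^ 2 / 3] for [0 <= t <= 1], the last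
    term being [eps] at [t ^ 2 = 1 - sqrt (3 eps)]. As the distance to the boundary
    is [`|f x| / norm2 w], both bounds follow by division; when [s = 0] the label
    never changes and both sides are [+oo]. *)

(** * Integration against the normal law and affine changes of variable *)

(** The Radon-Nikodym derivative of the law and [normal_pdf] have the same integral over every
    measurable set, hence agree almost everywhere. *)
Lemma ge0_integral_normal_prob (R : realType) (m s : R) (f : R -> \bar R) :
  measurable_fun [set: R] f -> (forall x, 0 <= f x)%E ->
  (\int[normal_prob m s]_x f x =
   \int[lebesgue_measure]_x (f x * (normal_pdf m s x)%:E))%E.
Proof.
move=> mf f0.
have dom := @normal_prob_dominates R m s.
rewrite -(Radon_Nikodym_SigmaFinite.change_of_variables dom)//.
apply: ae_eq_integral => //.
- apply: emeasurable_funM => //.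
  exact: (measurable_int _ (Radon_Nikodym_SigmaFinite.f_integrable dom)).
- apply: emeasurable_funM => //.
  by apply/measurable_EFinP; exact: measurable_normal_pdf.
- apply: ae_eqe_mul2l; apply: integral_ae_eq => //.
  + exact: Radon_Nikodym_SigmaFinite.f_integrable.
  + by apply/measurable_EFinP; exact: measurable_normal_pdf.
  + by move=> E _ mE; rewrite -Radon_Nikodym_SigmaFinite.f_integral.
Qed.

(** The image of Lebesgue measure under [x |-> a * x + b], scaled by [|a|], gives every half-open
    interval its length, so it is Lebesgue measure by uniqueness. *)
Lemma ge0_integral_affine (R : realType) (a b : R) (f : R -> \bar R) :
  a != 0 -> measurable_fun [set: R] f -> (forall x, 0 <= f x)%E ->
  (\int[lebesgue_measure]_x f x =
   `|a|%:E * \int[lebesgue_measure]_x f (a * x + b)%R)%E.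
Proof.
move=> a0 mf f0.
pose phi : measurableTypeR R -> measurableTypeR R := fun x => a * x + b.
have mphi : measurable_fun setT phi.
  by apply: measurable_funD => //; exact: measurable_funM.
pose k : {nonneg R} := NngNum (normr_ge0 a).
have eqm (A : set R) : measurable A ->
    lebesgue_measure A = mscale k (pushforward lebesgue_measure phi) A.
  move=> mA; apply: lebesgue_measure_unique => //= _ [[x y]] _ <-.
  rewrite /mscale/= /pushforward.
  have [agt|alt|az] := ltrgt0P a; last by rewrite az eqxx in a0.
    have -> : phi @^-1` `]x, y] = `](x - b) / a, (y - b) / a]%classic.
      apply/seteqP; split => z /=; rewrite !in_itv/= /phi;
      by rewrite ltr_pdivrMr// ler_pdivlMr// ltrBlDr lerBrDr mulrC.
    rewrite !lebesgue_measure_itv/= !lte_fin ltr_pM2r ?invr_gt0// ltrD2r.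
    case: ifPn => _; last by rewrite mule0.
    by rewrite -!EFinD -EFinM; congr EFin; field.
  (* A negative slope reverses the order, so the preimage is closed on the left and open on the
     right; its length is unaffected. *)
  have -> : phi @^-1` `]x, y] = `[(y - b) / a, (x - b) / a[%classic.
    apply/seteqP; split => z /=; rewrite !in_itv/= /phi;
    by rewrite ltr_ndivlMr// ler_ndivrMr// ltrBlDr lerBrDr mulrC andbC.
  rewrite !lebesgue_measure_itv/= !lte_fin ltr_nM2r ?invr_lt0// ltrD2r.
  case: ifPn => _; last by rewrite mule0.
  by rewrite -!EFinD -EFinM; congr EFin; field.
rewrite (eq_measure_integral (mscale k (pushforward lebesgue_measure phi)));
  last by move=> A mA _; exact: eqm.
rewrite ge0_integral_mscale// ge0_integral_pushforward//.
Qed.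

Lemma normal_peakE (R : realType) (s : R) :
  normal_peak s = (`|s| * Num.sqrt (pi *+ 2))^-1.
Proof. by rewrite /normal_peak -mulrnAr sqrtrM ?sqr_ge0// sqrtr_sqr. Qed.

Lemma normal_pdf_scale (R : realType) (m s x : R) : s != 0 ->
  `|s| * normal_pdf m s (s * x + m) = normal_pdf 0 1 x.
Proof.
move=> s0; rewrite !normal_pdfE ?oner_neq0// !normal_peakE /normal_fun.
rewrite invfM normr1 !mul1r subr0 addrK !mulrA divff ?normr_eq0// mul1r; congr (_ * expR _).
by field.
Qed.

(** Substitution in the density integral. The scale [s] may be negative, since the density sees only
    [|s|]; the value [-1] later yields the symmetry of N(0, 1). *)
Lemma normal_prob_affine (R : realType) (m s : R) (A : set R) :
  s != 0 -> measurable A ->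
  normal_prob 0 1 ((fun x => s * x + m) @^-1` A) = normal_prob m s A.
Proof.
move=> s0 mA.
have mpdf (m' s' : R) : measurable_fun [set: R] (fun x => (normal_pdf m' s' x)%:E).
  by apply/measurable_EFinP; exact: measurable_normal_pdf.
rewrite /normal_prob integral_mkcond [RHS]integral_mkcond.
rewrite [RHS](@ge0_integral_affine _ s m)//; last 2 first.
- by apply/(measurable_restrictT _ _).1 => //; exact: measurable_funTS.
- by move=> x; rewrite patchE; case: ifP => // _; rewrite lee_fin normal_pdf_ge0.
rewrite -ge0_integralZl//.
- apply: eq_integral => x _; rewrite !patchE.
  have -> : (x \in (fun x => s * x + m) @^-1` A) = (s * x + m \in A).
    by apply/idP/idP; rewrite !inE.
  by case: ifP => _; rewrite ?mule0// -EFinM normal_pdf_scale.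
- apply: measurableT_comp; first exact/(measurable_restrictT _ _).1/measurable_funTS.
  by apply: measurable_funD => //; exact: measurable_funM.
- by move=> x _; rewrite patchE; case: ifP => // _; rewrite lee_fin normal_pdf_ge0.
Qed.

(** * Law of a linear combination of independent standard Gaussians *)

(* Completing the square in [x] exhibits the posterior density of [x] given [a x + b y = z]. *)
Lemma normal_pdf_mul (R : realType) (a b x z : R) : b != 0 ->
  let c := Num.sqrt (a ^+ 2 + b ^+ 2) in
  normal_pdf (a * x) b z * normal_pdf 0 1 x =
  normal_pdf 0 c z * normal_pdf (a * z / c ^+ 2) (b / c) x.
Proof.
move=> b0 c; have ab0 : 0 < a ^+ 2 + b ^+ 2.
  by rewrite ltr_wpDl ?sqr_ge0// exprn_even_gt0.
have c2 : c ^+ 2 = a ^+ 2 + b ^+ 2 by rewrite sqr_sqrtr// ltW.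
have c0 : c != 0 by rewrite gt_eqF// sqrtr_gt0.
rewrite !normal_pdfE ?oner_neq0//; last by rewrite mulf_neq0// invr_neq0.
rewrite !normal_peakE /normal_fun normrM normfV normr1.
rewrite mulrACA [RHS]mulrACA -!expRD; congr (_ * expR _).
  have d0 : Num.sqrt (pi *+ 2) != 0 :> R.
    by rewrite gt_eqF// sqrtr_gt0 mulrn_wgt0// pi_gt0.
  by field; rewrite d0 !normr_eq0 c0 b0.
rewrite exprMn exprVn c2.
by field; rewrite b0 gt_eqF.
Qed.

(** Given the first coordinate [x], the combination has law N(a x, b^2). After exchanging integrals,
    [normal_pdf_mul] splits the integrand into the target density in [z] and a posterior density in
    [x] of total mass one. *)
Lemma normal_prob_combine (R : realType) (a b : R) (A : set R) :
  0 <= a -> measurable A ->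
  (normal_prob 0 1 \x normal_prob 0 1)%E [set p : R * R | A (a * p.1 + b * p.2)] =
  normal_prob 0 1 ((fun z => Num.sqrt (a ^+ 2 + b ^+ 2) * z) @^-1` A).
Proof.
move=> a0 mA; set g := normal_prob 0 1.
have mlin : measurable_fun [set: R * R] (fun p => a * p.1 + b * p.2).
  by apply: measurable_funD; apply: measurable_funM.
set X := [set p : R * R | _].
have mX : measurable X by rewrite -[X]setTI; exact: mlin.
have secX x : xsection X x = (fun y => b * y + a * x) @^-1` A :> set R.
  by rewrite predeqE => y; rewrite /xsection/= inE /X/= addrC.
rewrite /product_measure1/=.
(* For [b = 0] the conditional law is a Dirac mass without density: each section is the whole line
   or empty. Here [0 <= a] makes the square root of [a ^+ 2] equal to [a]. *)
have [bz|b0] := eqVneq b 0.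
  rewrite bz expr0n addr0 sqrtr_sqr ger0_norm//.
  transitivity (\int[g]_x (\1_((fun z => a * z) @^-1` A) x)%:E)%E.
    apply: eq_integral => x _; rewrite secX bz indicE.
    have [xA|xA] := boolP (x \in _); rewrite ?inE/= in xA.
      have -> : (fun y => 0 * y + a * x) @^-1` A = setT :> set R.
        by rewrite predeqE => y /=; rewrite mul0r add0r; split.
      exact: (probability_setT (normal_prob 0 1)).
    have -> : (fun y => 0 * y + a * x) @^-1` A = set0 :> set R.
      rewrite predeqE => y /=; rewrite mul0r add0r; split => // Ax.
      by move/negP: xA; rewrite inE.
    exact: (measure0 (normal_prob 0 1)).
  rewrite integral_indic ?setIT// -[X in measurable X]setTI.
  exact: measurable_funM.
rewrite ge0_integral_normal_prob//; last exact: measurable_fun_xsection.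
set c := Num.sqrt _.
have c0 : c != 0.
  by rewrite gt_eqF// sqrtr_gt0 ltr_wpDl ?sqr_ge0// exprn_even_gt0.
(* The joint density of [x] and [z = a x + b y], cut down to [z] in [A]. Centering the first factor
   at 0 makes measurability in the pair a matter of composition. *)
pose h (p : R * R) : \bar R :=
  (\1_A p.2 * (normal_pdf 0 b (p.2 - a * p.1) * normal_pdf 0 1 p.1))%:E.
have hE x z : h (x, z) = (\1_A z * (normal_pdf 0 c z *
    normal_pdf (a * z / c ^+ 2) (b / c) x))%:E.
  rewrite /h/= -normal_pdf_mul// !normal_pdfE ?oner_neq0//.
  by rewrite /normal_fun subr0.
have h0 p : (0 <= h p)%E by rewrite lee_fin !mulr_ge0 ?normal_pdf_ge0.
have mh : measurable_fun setT h.
  apply/measurable_EFinP; apply: measurable_funM.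
    by apply: measurableT_comp => //; exact: measurable_indic.
  apply: measurable_funM.
    apply: measurableT_comp; first exact: measurable_normal_pdf.
    by apply: measurable_funB => //; exact: measurable_funM.
  by apply: measurableT_comp => //; exact: measurable_normal_pdf.
transitivity (\int[lebesgue_measure]_x \int[lebesgue_measure]_z h (x, z))%E.
  apply: eq_integral => x _; rewrite secX /g normal_prob_affine//.
  rewrite /normal_prob integral_mkcond -ge0_integralZr//.
  - apply: eq_integral => z _; rewrite patchE /h/= indicE.
    case: ifP => _; rewrite ?mul0r ?mul0e// mul1r -EFinM; congr (_ * _)%:E.
    by rewrite !normal_pdfE// /normal_fun subr0.
  - apply/(measurable_restrictT _ _).1 => //; apply/measurable_EFinP.
    by apply: measurable_funTS; exact: measurable_normal_pdf.
  - by move=> z _; rewrite patchE; case: ifP => // _; rewrite lee_fin normal_pdf_ge0.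
  - by rewrite lee_fin normal_pdf_ge0.
rewrite fubini_tonelli//.
have -> : (fun z => c * z) @^-1` A = (fun z => c * z + 0) @^-1` A.
  by under [in RHS]eq_fun do rewrite addr0.
rewrite /g normal_prob_affine// /normal_prob [RHS]integral_mkcond.
apply: eq_integral => z _; under eq_integral do rewrite hE EFinM EFinM muleA.
rewrite ge0_integralZl//; last 3 first.
- by apply/measurable_EFinP; exact: measurable_normal_pdf.
- by move=> x _; rewrite lee_fin normal_pdf_ge0.
- by rewrite mule_ge0// lee_fin ?normal_pdf_ge0.
rewrite integral_normal_pdf mule1 patchE indicE.
by case: ifP => _; rewrite ?mul0e ?mul1e.
Qed.

(** Measurable rectangles are stable under intersection, contain the whole space and generate the
    product sigma-algebra. *)
Lemma finite_measure_prod_unique (d1 d2 : measure_display)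
    (T1 : measurableType d1) (T2 : measurableType d2) (R : realType)
    (m1 m2 : {measure set (T1 * T2) -> \bar R}) :
  (m1 setT < +oo)%E ->
  (forall A B, measurable A -> measurable B -> m1 (A `*` B) = m2 (A `*` B)) ->
  forall X, measurable X -> m1 X = m2 X.
Proof.
move=> fin m12 X mX.
pose C : set (set (T1 * T2)) :=
  [set C | exists2 A, measurable A & exists2 B, measurable B & A `*` B = C].
apply: (measure_unique C (fun=> setT)) => //.
- rewrite measurable_prod_measurableType; congr (<<s _ >>).
- move=> _ _ [A1 mA1 [B1 mB1 <-]] [A2 mA2 [B2 mB2 <-]].
  exists (A1 `&` A2); first exact: measurableI.
  by exists (B1 `&` B2); [exact: measurableI|rewrite setXI].
- by move=> _; exists setT => //; exists setT => //; rewrite setXTT.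
- by rewrite bigcup_const.
- by move=> _ [A mA [B mB <-]]; exact: m12.
Qed.

(** Induction on the number [n] of terms merged into one Gaussian. Carrying the constraints [B] on
    the remaining coordinates keeps their independence from the partial sum available at the next
    step. *)
Lemma normal_sum_joint (R : realType) (d0 : measure_display)
    (T : measurableType d0) (P : probability T R) (d : nat)
    (Z : 'I_d -> {RV P >-> R}) (u : 'I_d -> R) :
  std_normal_family Z -> mutually_independent Z ->
  forall n, (n <= d)%N -> forall (B : 'I_d -> set R) (A : set R),
  (forall i, measurable (B i)) -> measurable A ->
  P [set om | A (\sum_(i < d | (i < n)%N) u i * Z i om) /\
              forall i : 'I_d, (n <= i)%N -> B i (Z i om)] =
  (normal_prob 0 1
     ((fun z => Num.sqrt (\sum_(i < d | (i < n)%N) u i ^+ 2) * z)%R @^-1` A) *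
   (\prod_(i < d | (n <= i)%N) fine (normal_prob 0 1 (B i)))%:E)%E.
Proof.
move=> hZ hind; elim => [_|n IH nd] B A mB mA.
  (* With no term, the sum and the scale are both 0, so the preimage of [A] is everything or nothing
     according to whether 0 lies in [A]. *)
  rewrite big_pred0// sqrtr0.
  have [A0|A0] := pselect (A 0).
    rewrite (_ : _ @^-1` A = setT); last first.
      by rewrite predeqE => z /=; rewrite mul0r.
    rewrite probability_setT mul1e.
    transitivity (P [set om | forall i, B i (Z i om)]).
      congr (P _); rewrite predeqE => om /=; rewrite big_pred0//.
      by split => [[_ BZ] i|BZ]; [exact: BZ|split => // i _].
    rewrite hind// -prodEFin; apply: eq_bigr => i _.
    rewrite hZ// fineK//. exact: (fin_num_measure (normal_prob 0 1) (B i) (mB i)).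
  rewrite (_ : _ @^-1` A = set0); last first.
    by rewrite predeqE => z /=; rewrite mul0r.
  rewrite measure0 mul0e (_ : [set om | _] = set0) ?measure0//.
  by rewrite predeqE => om /=; rewrite big_pred0//; split => [[]|].
pose k := Ordinal nd.
have mZ i : measurable_fun [set: T] (Z i : T -> R) by [].
pose Y (om : T) := \sum_(i < d | (i < n)%N) u i * Z i om.
have mY : measurable_fun [set: T] Y.
  rewrite /Y; under eq_fun do rewrite big_mkcond/=.
  apply: measurable_sum => i; case: (i < n)%N => //; exact: measurable_funM.
pose C := [set om | forall i : 'I_d, (n.+1 <= i)%N -> B i (Z i om)].
have mC : measurable C.
  rewrite (_ : C = \bigcap_(i in [set i : 'I_d | (n < i)%N]) (Z i @^-1` B i)); last first.
    by rewrite predeqE.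
  apply: fin_bigcap_measurable => // i _.
  by rewrite -[X in measurable X]setTI; exact: mZ.
pose s := Num.sqrt (\sum_(i < d | (i < n)%N) u i ^+ 2).
pose c := \prod_(i < d | (n.+1 <= i)%N) fine (normal_prob 0 1 (B i)).
have c0 : 0 <= c by apply: prodr_ge0 => i _; exact: fine_ge0.
pose phi om := (Y om, Z k om).
have mphi : measurable_fun [set: T] phi by exact: measurable_fun_pair.
(* By induction the partial sum [Y] is distributed as [s] times a standard Gaussian; [psi] turns a
   standard Gaussian pair into a model of [phi]. *)
pose psi (p : measurableTypeR R * measurableTypeR R) : R * R := (s * p.1, p.2).
have mpsi : measurable_fun setT psi.
  by apply: measurable_fun_pair => //; exact: measurable_funM.
pose X := [set p : R * R | A (p.1 + u k * p.2)].
have mX : measurable X.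
  rewrite -[X]setTI; have : measurable_fun [set: R * R] (fun p => p.1 + u k * p.2).
    by apply: measurable_funD => //; exact: measurable_funM.
  by apply.
have sumS (F : 'I_d -> R) : \sum_(i < d | (i < n.+1)%N) F i =
    \sum_(i < d | (i < n)%N) F i + F k.
  rewrite (bigD1 k)//= addrC; congr (_ + _); apply: eq_bigl => i.
  by rewrite ltnS -val_eqE/= andbC -ltn_neqAle.
(* Both sides are finite measures in [E], so rectangles suffice; there the induction hypothesis
   applies with the second side of the rectangle as the constraint on [Z k]. *)
have rect E : measurable E -> P (phi @^-1` E `&` C) =
    (c%:E * (normal_prob 0 1 \x normal_prob 0 1) (psi @^-1` E))%E.
  apply: (@finite_measure_prod_unique _ _ R R R
      (pushforward (mrestr P mC) phi)
      (mscale (NngNum c0)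
        (pushforward (normal_prob 0 1 \x normal_prob 0 1)%E psi))) => //.
    change (P (phi @^-1` setT `&` C) < +oo)%E; rewrite preimage_setT setTI.
    by rewrite (le_lt_trans (probability_le1 _ _))// ltry.
  move=> F G mF mG.
  pose B' i := if i == k then G else B i.
  have mB' i : measurable (B' i) by rewrite /B'; case: ifP.
  transitivity (P [set om | F (Y om) /\ forall i : 'I_d, (n <= i)%N -> B' i (Z i om)]).
    rewrite /pushforward /mrestr; congr (P _); rewrite predeqE => om /=.
    split => [[[FY GZ] CZ]|[FY BZ]].
      split => // i ni; rewrite /B'; case: eqVneq => [->//|ik].
      by apply: CZ; rewrite ltn_neqAle ni andbT eq_sym.
    split; first by split => //; have := BZ k (leqnn _); rewrite /B' eqxx.
    move=> i ni; have := BZ i (ltnW ni); rewrite /B' ifN//.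
    by rewrite -val_eqE/= gtn_eqF.
  rewrite (IH (ltnW nd) B' F mB' mF) [X in (_ * X%:E)%E](bigD1 k)//= {1}/B' eqxx.
  rewrite (_ : \prod_(i < d | _) _ = c); last first.
    apply: eq_big => i; first by rewrite -val_eqE/= eq_sym andbC -ltn_neqAle.
    by move=> /andP[_ ik]; rewrite /B' (negbTE ik).
  rewrite /mscale/= /pushforward.
  have -> : psi @^-1` (F `*` G) = ((fun z => s * z) @^-1` F) `*` G by [].
  rewrite product_measure1E//; last first.
    by rewrite -[X in measurable X]setTI; exact: measurable_funM.
  rewrite EFinM fineK; last exact: (fin_num_measure (normal_prob 0 1) G mG).
  by rewrite muleA muleC.
transitivity (P (phi @^-1` X `&` C)).
  by congr (P _); rewrite predeqE => om; rewrite /X /= sumS.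
rewrite rect//.
rewrite (_ : psi @^-1` X = [set p | A (s * p.1 + u k * p.2)])//.
rewrite normal_prob_combine ?sqrtr_ge0// muleC sqr_sqrtr ?sumS//.
by apply: sumr_ge0 => i _; exact: sqr_ge0.
Qed.

Lemma normal_sum_law (R : realType) (d0 : measure_display)
    (T : measurableType d0) (P : probability T R) (d : nat)
    (Z : 'I_d -> {RV P >-> R}) (u : 'I_d -> R) (A : set R) :
  std_normal_family Z -> mutually_independent Z -> measurable A ->
  P [set om | A (\sum_(i < d) u i * Z i om)] =
  normal_prob 0 1 ((fun z => Num.sqrt (\sum_(i < d) u i ^+ 2) * z) @^-1` A).
Proof.
move=> hZ hind mA.
have /(_ (fun=> setT) A) := @normal_sum_joint R d0 T P d Z u hZ hind d (leqnn d).
have full (F : 'I_d -> R) : \sum_(i < d | (i < d)%N) F i = \sum_(i < d) F i.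
  by apply: eq_bigl => i; rewrite ltn_ord.
rewrite [X in (_ * X%:E)%E]big_pred0 ?mule1; last by move=> i; rewrite leqNgt ltn_ord.
rewrite full => <-//; congr (P _); rewrite predeqE => om /=.
by rewrite full; split => // -[].
Qed.

(** * Gaussian tail estimates *)

(* The tail density at [z] is at most [expR (- m ^+ 2 / 2)] times the density of N(m, 1), where [m = F / c] is the threshold. *)
Lemma normal_tail_le (R : realType) (c F : R) : c != 0 -> 0 < F ->
  (normal_prob 0 1 [set z | (F <= c * z)%R] <=
   (expR (- (F ^+ 2 / (2 * c ^+ 2))))%:E)%E.
Proof.
move=> c0 F0; set D := [set z | _]; pose m := F / c.
have mD : measurable D.
  have -> : D = (fun z => c * z) @^-1` `[F, +oo[.
    by rewrite predeqE => z /=; rewrite in_itv/= andbT.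
  rewrite -[X in measurable X]setTI.
  have : measurable_fun [set: R] (fun z => c * z) by exact: measurable_funM.
  by apply.
set e := expR _.
have mpdf (m' : R) : measurable_fun D (fun x => (normal_pdf m' 1 x)%:E).
  apply/measurable_EFinP; apply: measurable_funTS; exact: measurable_normal_pdf.
apply: (@le_trans _ _ (e%:E * normal_prob m 1 D)%E); last first.
  rewrite -[leRHS]mule1 lee_wpmul2l ?lee_fin ?expR_ge0//.
  exact: (probability_le1 (normal_prob m 1)).
rewrite /normal_prob -ge0_integralZl//; last 3 first.
- exact: mpdf.
- by move=> z _; rewrite lee_fin normal_pdf_ge0.
- by rewrite lee_fin expR_ge0.
apply: ge0_le_integral => //.
- by move=> z _; rewrite lee_fin normal_pdf_ge0.
- exact: mpdf.
- by apply: measurable_funeM; exact: mpdf.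
move=> z Dz; rewrite -EFinM lee_fin !normal_pdfE ?oner_neq0//.
rewrite mulrCA ler_wpM2l ?normal_peak_ge0// /normal_fun -expRD ler_expR.
have c2 : 0 < c ^+ 2 by rewrite exprn_even_gt0.
(* This is [F <= c * z] multiplied by the positive number [F / c ^+ 2]; it is what the comparison of
   [- z ^ 2 / 2] with [- m ^ 2 / 2 - (z - m) ^ 2 / 2] amounts to. *)
have mz : m ^+ 2 <= m * z.
  rewrite -subr_ge0 (_ : _ - _ = F * (c * z - F) / c ^+ 2); last by rewrite /m; field.
  by apply: divr_ge0; [apply: mulr_ge0; [exact: ltW|rewrite subr_ge0]|exact: ltW].
rewrite (_ : F ^+ 2 / (2 * c ^+ 2) = m ^+ 2 / 2); last by rewrite /m; field.
by lra.
Qed.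

(** The two open half-lines have equal mass by symmetry, and the origin is null by absolute
    continuity. *)
Lemma normal_prob_pos (R : realType) :
  normal_prob 0 1 [set z : R | 0 < z] = (2^-1)%:E.
Proof.
set g := normal_prob 0 1.
have mpos : measurable [set z : R | 0 < z].
  rewrite (_ : [set z | _] = `]0, +oo[%classic)//.
  by rewrite predeqE => z /=; rewrite in_itv/= andbT.
have mneg : measurable [set z : R | z < 0].
  rewrite (_ : [set z | _] = `]-oo, 0[%classic)//.
have sym : g [set z : R | z < 0] = g [set z : R | 0 < z].
  have := @normal_prob_affine R 0 (-1) _ _ mpos.
  rewrite oppr_eq0 oner_eq0 => /(_ isT).
  rewrite (_ : _ @^-1` _ = [set z | z < 0]); last first.
    by rewrite predeqE => z /=; rewrite mulN1r addr0 oppr_gt0.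
  rewrite /g => ->; rewrite /normal_prob; apply: eq_integral => z _.
  by rewrite !normal_pdfE ?oppr_eq0 ?oner_eq0// !normal_peakE /normal_fun sqrrN normrN.
have g0 : g [set 0] = 0%E.
  have /null_content_dominatesP := @normal_prob_dominates R 0 1.
  by apply => //; exact: lebesgue_measure_set1.
have setTE : setT = [set z : R | 0 < z] `|` ([set z : R | z < 0] `|` [set 0]).
  by rewrite predeqE => z; split => // _ /=; case: (ltrgt0P z); auto.
have : g setT = 1%E by exact: (probability_setT (normal_prob 0 1)).
rewrite setTE /g measureU//; last 2 first.
- exact: measurableU.
- rewrite predeqE => z; split => // -[/= z0 [z1|z1]]; last by move: z0; rewrite z1 ltxx.
  by have := lt_trans z0 z1; rewrite ltxx.
rewrite measureU//; last first.
  by rewrite predeqE => z; split => // -[/= z0 z1]; move: z0; rewrite z1 ltxx.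
rewrite /= -/g sym g0 adde0 /g.
have : normal_prob 0 1 [set z : R | 0 < z] \is a fin_num.
  exact: (fin_num_measure (normal_prob 0 1) _ mpos).
case: (normal_prob 0 1 _) => // r _; rewrite -EFinD => -[rr]; congr EFin.
by lra.
Qed.

(** The density is at most 1/2, because [pi >= 2] gives [sqrt (2 pi) >= 2]; hence []0, t]] takes at
    most [t / 2] away from the mass 1/2 of the positive half-line. *)
Lemma normal_tail_ge (R : realType) (t : R) : 0 <= t ->
  ((2^-1 - t / 2)%:E <= normal_prob 0 1 [set z : R | (t < z)%R])%E.
Proof.
move=> t0.
have mt : measurable [set z : R | t < z].
  rewrite (_ : [set z | _] = `]t, +oo[%classic)//.
  by rewrite predeqE => z /=; rewrite in_itv/= andbT.
have split_pos : [set z : R | 0 < z] = `]0, t]%classic `|` [set z : R | t < z].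
  rewrite predeqE => z /=; rewrite in_itv/=; split => [z0|[/andP[]//|]].
    by case: (leP z t) => zt; [left; rewrite z0|right].
  exact: le_lt_trans.
have small : (normal_prob 0 1 `]0%R, t]%classic <= (t / 2)%:E)%E.
  apply: (@le_trans _ _ (\int[lebesgue_measure]_(x in `]0%R, t]%classic) (cst (2^-1)%:E x))%E).
    apply: ge0_le_integral => //.
    - by move=> z _; rewrite lee_fin normal_pdf_ge0.
    - apply/measurable_EFinP; apply: measurable_funTS; exact: measurable_normal_pdf.
    - move=> z _; rewrite lee_fin (le_trans (normal_pdf_ub _ _ (oner_neq0 _)))//.
      rewrite normal_peakE normr1 mul1r lef_pV2 ?posrE ?ltr0n//; last first.
        by rewrite sqrtr_gt0 mulrn_wgt0// pi_gt0.
      rewrite -[leLHS]ger0_norm// -sqrtr_sqr ler_wsqrtr//.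
      by have := pi_ge2 R; rewrite -mulr_natr; lra.
  rewrite integral_cst//= lebesgue_measure_itv/= lte_fin.
  case: ifPn => [_|]; last by rewrite mule0 lee_fin divr_ge0.
  by rewrite -EFinD -EFinM lee_fin subr0 mulrC.
have := normal_prob_pos R; rewrite split_pos measureU//; last first.
  rewrite predeqE => z; split => // -[/=]; rewrite in_itv/= => /andP[_ zt] tz.
  by have := le_lt_trans zt tz; rewrite ltxx.
rewrite /=; move: small.
have : normal_prob 0 1 [set z : R | t < z] \is a fin_num.
  exact: (fin_num_measure (normal_prob 0 1) _ mt).
have : normal_prob 0 1 (`]0%R, t]%classic : set R) \is a fin_num.
  exact: (fin_num_measure (normal_prob 0 1) _ (measurable_itv _)).
case: (normal_prob 0 1 _) => // r _; case: (normal_prob 0 1 _) => // q _.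
rewrite -EFinD !lee_fin => rt -[rq].
by lra.
Qed.

(** * Euclidean norm and the Cauchy-Schwarz inequality *)

Lemma dotE (R : realType) (d : nat) (u v : 'cV[R]_d) :
  (u^T *m v) 0 0 = \sum_(i < d) u i 0 * v i 0.
Proof. by rewrite mxE; apply: eq_bigr => i _; rewrite mxE. Qed.

Lemma norm2_sqr (R : realType) (d : nat) (u : 'cV[R]_d) :
  norm2 u ^+ 2 = \sum_(i < d) u i 0 ^+ 2.
Proof. by rewrite sqr_sqrtr// sumr_ge0// => i _; rewrite sqr_ge0. Qed.

Lemma norm2_gt0 (R : realType) (d : nat) (u : 'cV[R]_d) : u != 0 -> 0 < norm2 u.
Proof.
move=> u0; rewrite lt_neqAle sqrtr_ge0 andbT eq_sym.
apply: contraNneq u0 => nu; apply/eqP/matrixP => i j; rewrite ord1 mxE.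
have /eqP := norm2_sqr u; rewrite nu expr0n eq_sym psumr_eq0; last first.
  by move=> k _; exact: sqr_ge0.
by move/allP/(_ i (mem_index_enum _))/eqP/eqP; rewrite sqrf_eq0 => /eqP.
Qed.

Lemma norm2Z (R : realType) (d : nat) (a : R) (u : 'cV[R]_d) :
  norm2 (a *: u) = `|a| * norm2 u.
Proof.
rewrite /norm2 -sqrtr_sqr -sqrtrM ?sqr_ge0// mulr_sumr; congr Num.sqrt.
by apply: eq_bigr => i _; rewrite mxE exprMn.
Qed.

(** Cauchy-Schwarz, by expanding the squared norm of [A ^ 2 v - C u], which equals
    [A ^ 2 ((A B) ^ 2 - C ^ 2)]. *)
Lemma dot_le_norm2 (R : realType) (d : nat) (u v : 'cV[R]_d) :
  (u^T *m v) 0 0 <= norm2 u * norm2 v.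
Proof.
have [->|u0] := eqVneq u 0.
  by rewrite trmx0 mul0mx mxE mulr_ge0// sqrtr_ge0.
set A := norm2 u; set B := norm2 v; set C := (_ *m _) 0 0.
have A0 : 0 < A by exact: norm2_gt0.
rewrite (le_trans (ler_norm C))// -ler_sqr ?nnegrE ?mulr_ge0 ?sqrtr_ge0// real_normK ?num_real//.
have : 0 <= \sum_(i < d) (A ^+ 2 * v i 0 - C * u i 0) ^+ 2.
  by apply: sumr_ge0 => i _; exact: sqr_ge0.
rewrite (eq_bigr (fun i => A ^+ 2 * A ^+ 2 * v i 0 ^+ 2 +
    ((- 2 * A ^+ 2 * C) * (u i 0 * v i 0) + C ^+ 2 * u i 0 ^+ 2))); last first.
  by move=> i _; ring.
rewrite !big_split/= -!mulr_sumr -!norm2_sqr -dotE -/A -/B -/C.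
rewrite (_ : _ + _ = A ^+ 2 * ((A * B) ^+ 2 - C ^+ 2)); last by ring.
by rewrite pmulr_rge0 ?exprn_gt0// subr_ge0.
Qed.

(** * Label changes and the distance to the decision boundary *)

(* In the direction [flip_sign f] the score [f] of a point decreases in absolute value. *)
Definition flip_sign (R : realType) (f : R) : R := if 0 < f then -1 else 1.

(** The hyperplane itself carries label 0: reaching it flips a point of positive score, whereas a
    point of negative score has to cross it strictly. *)
Definition flip_set (R : realType) (f : R) : set R :=
  [set y | if 0 < f then `|f| <= y else `|f| < y].

Lemma label_flipP (R : realType) (d : nat) (w : 'cV[R]_d) (b : R) (x r : 'cV[R]_d) :
  linf w b x != 0 ->
  (label w b (x + r) != label w b x) <->
  flip_set (linf w b x) (flip_sign (linf w b x) * (w^T *m r) 0 0).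
Proof.
have -> : label w b (x + r) = if 0 < linf w b x + (w^T *m r) 0 0 then 1%N else 0%N.
  by rewrite /label /linf mulmxDr mxE addrAC.
rewrite /label /flip_set /flip_sign /=; set f := linf w b x; set y := (_ *m _) 0 0.
move=> f0; have [fpos|fneg] := ltP 0 f.
  rewrite gtr0_norm// mulN1r -subr_le0 opprK leNgt.
  by case: (0 < f + y); split.
rewrite ler0_norm// mul1r -[- f < y]subr_gt0 opprK (addrC y).
by case: (0 < f + y); split.
Qed.

Lemma measurable_flip_set (R : realType) (f : R) : measurable (flip_set f).
Proof.
rewrite /flip_set; case: (0 < f).
  rewrite (_ : [set _ | _] = `[`|f|, +oo[%classic)//.
  by rewrite predeqE => z /=; rewrite in_itv/= andbT.
rewrite (_ : [set _ | _] = `]`|f|, +oo[%classic)//.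
by rewrite predeqE => z /=; rewrite in_itv/= andbT.
Qed.

Lemma flip_set_ge (R : realType) (f y : R) : flip_set f y -> `|f| <= y.
Proof. by rewrite /flip_set/=; case: ifP => // _ /ltW. Qed.

Lemma gt_flip_set (R : realType) (f y : R) : `|f| < y -> flip_set f y.
Proof. by rewrite /flip_set/=; case: ifP => // _ /ltW. Qed.

Lemma normr_flip_sign (R : realType) (f : R) : `|flip_sign f| = 1.
Proof. by rewrite /flip_sign; case: ifP => _; rewrite ?normrN normr1. Qed.

Lemma flip_sign_mulss (R : realType) (f : R) : flip_sign f * flip_sign f = 1.
Proof. by rewrite /flip_sign; case: ifP => _; rewrite ?mulrNN mulr1. Qed.

(** Cauchy-Schwarz bounds every flipping displacement from below; a displacement along [w] comes
    arbitrarily close to that bound. *)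
Lemma dist_boundaryE (R : realType) (d : nat) (w : 'cV[R]_d) (b : R) (x : 'cV[R]_d) :
  w != 0 -> linf w b x != 0 ->
  dist_boundary w b x = (`|linf w b x| / norm2 w)%:E.
Proof.
move=> w0 f0; have nw := norm2_gt0 w0.
set f := linf w b x in f0 *; set s := flip_sign f.
apply/eqP; rewrite eq_le; apply/andP; split.
  apply/lee_addgt0Pr => e e0; apply: ge_ereal_inf.
  (* The normal step with an overshoot [e], of norm exactly [|f| / norm2 w + e]; the overshoot
     secures the strict crossing. *)
  pose r := (s * ((`|f| + e * norm2 w) / norm2 w ^+ 2)) *: w.
  exists (norm2 r)%:E.
    exists r => //=; apply/(label_flipP _ f0); apply: gt_flip_set.
    rewrite -/f -/s /r -scalemxAr mxE dotE.
    under eq_bigr do rewrite -expr2.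
    rewrite -norm2_sqr -mulrA divfK ?sqrf_eq0 ?gt_eqF// mulrA flip_sign_mulss mul1r.
    by rewrite ltrDl mulr_gt0.
  rewrite -EFinD lee_fin norm2Z normrM normr_flip_sign mul1r ger0_norm; last first.
    by rewrite divr_ge0 ?sqr_ge0// addr_ge0// mulr_ge0// ltW.
  by rewrite le_eqVlt; apply/orP; left; apply/eqP; field; rewrite gt_eqF.
apply/ereal_infP => _ [r /= /(label_flipP _ f0) /flip_set_ge rf <-].
rewrite lee_fin ler_pdivrMr// mulrC (le_trans rf)//.
have -> : s * (w^T *m r) 0 0 = (w^T *m (s *: r)) 0 0.
  by rewrite -scalemxAr [RHS]mxE.
by rewrite (le_trans (dot_le_norm2 _ _))// norm2Z normr_flip_sign mul1r.
Qed.

(** * Flip probabilities and the two bounds on [r_sigma] *)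

(** Symmetry of [S] turns [w^T S Z] into the combination of the [Z i] with coefficients [S w], whose
    law [normal_sum_law] provides. *)
Lemma flip_probE (R : realType) (d : nat) (S : 'M[R]_d) (d0 : measure_display)
    (T : measurableType d0) (P : probability T R) (Z : 'I_d -> {RV P >-> R})
    (w : 'cV[R]_d) (b : R) (x : 'cV[R]_d) (a : R) :
  S^T = S -> std_normal_family Z -> mutually_independent Z ->
  linf w b x != 0 ->
  P [set om | label w b (x + a *: gauss_vec S Z om) != label w b x] =
  normal_prob 0 1 ((fun z => `|a| * norm2 (S *m w) * z) @^-1` flip_set (linf w b x)).
Proof.
move=> trS hZ hind f0; set s := flip_sign (linf w b x).
pose u := s *: (a *: (S *m w)).
have -> : `|a| * norm2 (S *m w) = norm2 u by rewrite !norm2Z normr_flip_sign mul1r.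
rewrite -(@normal_sum_law _ _ _ _ _ Z (fun i => u i 0) _ hZ hind (measurable_flip_set _)).
congr (P _); rewrite predeqE => om.
suff E : s * (w^T *m (a *: gauss_vec S Z om)) 0 0 =
   \sum_(i < d) u i 0 * Z i om.
  by split => [/(label_flipP _ f0)|] /=; [|move=> H; apply/(label_flipP _ f0)]; rewrite E.
rewrite -scalemxAr /gauss_vec mulmxA -[w^T *m S]trmxK trmx_mul trmxK trS.
rewrite [in LHS]mxE dotE !mulr_sumr; apply: eq_bigr => i _.
by rewrite !mxE !mulrA.
Qed.

(** Each admissible [a] satisfies [eps <= exp (- F ^ 2 / (2 (|a| s) ^ 2))]; solving for [|a|] gives
    the bound. *)
Lemma r_sigma_ge (R : realType) (d : nat) (S : 'M[R]_d) (d0 : measure_display)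
    (T : measurableType d0) (P : probability T R) (Z : 'I_d -> {RV P >-> R})
    (w : 'cV[R]_d) (b : R) (x : 'cV[R]_d) (eps : R) :
  S^T = S -> std_normal_family Z -> mutually_independent Z ->
  linf w b x != 0 -> 0 < eps -> eps < 1 ->
  (efrac (Num.sqrt (1 / (2 * ln (1 / eps))) * `|linf w b x|)%:E (norm2 (S *m w))%:E
   <= r_sigma S Z w b eps x)%E.
Proof.
move=> trS hZ hind f0 e0 e1; apply/ereal_infP => _ [a /= + <-].
rewrite flip_probE// => le_eps.
have F0 : 0 < `|linf w b x| by rewrite normr_gt0.
set F := `|_| in F0 *; set s := norm2 _ in le_eps *.
(* A zero scale never flips the label, which contradicts [0 < eps]; so for [s = 0] no [a] is
   admissible. *)
have [c0|c0] := eqVneq (`|a| * s) 0.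
  move: le_eps; rewrite c0 (_ : _ @^-1` _ = set0); last first.
    by rewrite predeqE => z; split => //= /flip_set_ge; rewrite mul0r leNgt F0.
  by rewrite measure0 lee_fin leNgt e0.
have s0 : s != 0 by apply: contraNneq c0 => ->; rewrite mulr0.
have sp : 0 < s by rewrite lt_neqAle eq_sym s0 sqrtr_ge0.
have le2 : eps <= expR (- (F ^+ 2 / (2 * (`|a| * s) ^+ 2))).
  rewrite -lee_fin (le_trans le_eps)// (le_trans _ (normal_tail_le c0 F0))//.
  apply: (@le_measure _ _ _ (normal_prob 0 1)); rewrite ?inE.
  - rewrite -[X in measurable X]setTI; apply: measurable_funM => //.
    exact: measurable_flip_set.
  - rewrite (_ : [set z | _] = (fun z => `|a| * s * z) @^-1` `[F, +oo[%classic); last first.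
      by rewrite predeqE => z /=; rewrite in_itv/= andbT.
    by rewrite -[X in measurable X]setTI; exact: measurable_funM.
  - by move=> z /flip_set_ge.
have L0 : 0 < ln (1 / eps) by rewrite ln_gt0// ltr_pdivlMr ?mul1r.
have le3 : F ^+ 2 / (2 * (`|a| * s) ^+ 2) <= ln (1 / eps).
  by rewrite div1r lnV// lerNr -ler_expR lnK.
rewrite /efrac eqe (negbTE s0) inver (negbTE s0) -EFinM lee_fin ler_pdivrMr//.
rewrite -ler_sqr ?nnegrE ?mulr_ge0 ?sqrtr_ge0 ?(ltW F0)//.
rewrite [leLHS]exprMn sqr_sqrtr ?divr_ge0// ?mulr_ge0// ?(ltW L0)//.
have a2 : 0 < (`|a| * s) ^+ 2 by rewrite exprn_even_gt0.
move: le3; rewrite ler_pdivrMr; last exact: mulr_gt0.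
move=> le3.
rewrite div1r mulrC ler_pdivrMr ?mulr_gt0// (le_trans le3)//.
by rewrite [leRHS](_ : _ = ln (1 / eps) * (2 * (`|a| * s) ^+ 2))//; ring.
Qed.

Lemma r_sigma_le (R : realType) (d : nat) (S : 'M[R]_d) (d0 : measure_display)
    (T : measurableType d0) (P : probability T R) (Z : 'I_d -> {RV P >-> R})
    (w : 'cV[R]_d) (b : R) (x : 'cV[R]_d) (eps : R) :
  S^T = S -> std_normal_family Z -> mutually_independent Z ->
  linf w b x != 0 -> 0 < eps -> eps < 1 / 3 ->
  (r_sigma S Z w b eps x <=
   efrac (Num.sqrt (1 / (1 - Num.sqrt (3 * eps))) * `|linf w b x|)%:E (norm2 (S *m w))%:E)%E.
Proof.
move=> trS hZ hind f0 e0 e1.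
have F0 : 0 < `|linf w b x| by rewrite normr_gt0.
set F := `|_| in F0 *; set s := norm2 _.
rewrite /efrac eqe; have [//|s0] := eqVneq s 0; first by rewrite leey.
have sp : 0 < s by rewrite lt_neqAle eq_sym s0 sqrtr_ge0.
rewrite inver (negbTE s0) -EFinM.
set q := Num.sqrt (3 * eps); set t := Num.sqrt (1 / (1 - q)).
have q0 : 0 <= q by exact: sqrtr_ge0.
have q2 : q ^+ 2 = 3 * eps by rewrite sqr_sqrtr//; lra.
(* The hypothesis [eps < 1 / 3] enters here and makes [1 - q] positive. *)
have q1 : q < 1 by rewrite -(ltr_sqr q0 ler01)//; rewrite q2; lra.
have t0 : 0 < t by rewrite sqrtr_gt0 divr_gt0// subr_gt0.
have t2 : t ^- 2 = 1 - q by rewrite sqr_sqrtr ?div1r ?invrK// invr_ge0 subr_ge0 ltW.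
(* With [a = t F / s], the condition [|a| s z > F] becomes [z > 1 / t]. *)
apply: ge_ereal_inf; exists `|t * F / s|%:E; last first.
  by rewrite ger0_norm// divr_ge0 ?sqrtr_ge0// mulr_ge0// ltW.
exists (t * F / s) => //=; rewrite flip_probE// -/s -/F.
have ut0 : 0 <= t^-1 by rewrite invr_ge0 ltW.
apply: (@le_trans _ _ (2^-1 - t^-1 / 2)%:E).
  rewrite lee_fin (_ : eps = q ^+ 2 / 3); last by rewrite q2; field.
  have : q = 1 - t^-1 ^+ 2 by rewrite exprVn t2; ring.
  move=> ->; move: ut0 (t2); rewrite -exprVn; set u := t^-1 => u0 u2.
  have u1 : u <= 1 by rewrite -(ler_sqr u0 ler01)//; rewrite u2; lra.
  (* Here [eps = (1 - u ^ 2) ^ 2 / 3]. Factoring out [1 - u] leaves [(1 - u) (1 + u) ^ 2 <= 3 / 2]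
     to prove. *)
  rewrite -subr_ge0 (_ : _ - _ = (1 - u) * (2^-1 - (1 - u) * (1 + u) ^+ 2 / 3)); last by field.
  rewrite mulr_ge0 ?subr_ge0//.
  (* The maximum of [(1 - u) * (1 + u) ^+ 2] is [32 / 27], reached at [u = 1 / 3]. *)
  have : (1 - u) * (1 + u) ^+ 2 = 32 / 27 - (u - 1 / 3) ^+ 2 * (u + 5 / 3) by field.
  have : 0 <= (u - 1 / 3) ^+ 2 * (u + 5 / 3) by rewrite mulr_ge0 ?sqr_ge0//; lra.
  lra.
apply: (le_trans (normal_tail_ge ut0)).
apply: (@le_measure _ _ _ (normal_prob 0 1)); rewrite ?inE.
- rewrite (_ : [set z | _] = `]t^-1, +oo[%classic)//.
  by rewrite predeqE => z /=; rewrite in_itv/= andbT.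
- rewrite -[X in measurable X]setTI; apply: measurable_funM => //.
  exact: measurable_flip_set.
- move=> z /= tz; apply: gt_flip_set; rewrite -/F ger0_norm; last first.
    by rewrite divr_ge0 ?mulr_ge0// ltW.
  by rewrite divfK// mulrAC ltr_pMl// -(mulfV (lt0r_neq0 t0)) ltr_pM2l.
Qed.

(** * From bounds on [r_sigma] to bounds on the ratio *)

(** When [s = 0] both sides are [+oo], as [c] is positive. *)
Lemma efracM (R : realType) (c k s : R) : 0 < c ->
  (efrac (c * k)%:E s%:E = c%:E * efrac k%:E s%:E)%E.
Proof.
move=> c0; rewrite /efrac eqe; case: ifPn => s0; first by rewrite gt0_muley ?lte_fin.
by rewrite EFinM muleA.
Qed.

Theorem theorem2 (R : realType) (d : nat) (hd : (0 < d)%N)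
  (Sigma S : 'M[R]_d) (hSigma : psd Sigma) (htr : \tr Sigma = 1)
  (hS : psd S) (hSS : S *m S = Sigma)
  (d0 : measure_display) (T : measurableType d0) (P : probability T R)
  (Z : 'I_d -> {RV P >-> R})
  (hZ : std_normal_family Z) (hind : mutually_independent Z)
  (w : 'cV[R]_d) (hw : w != 0) (b : R) (x : 'cV[R]_d)
  (hx : linf w b x != 0) (eps : R) (heps0 : 0 < eps) (heps1 : eps < 1 / 3) :
  ((Num.sqrt (1 / (2 * ln (1 / eps))))%:E
     * efrac (norm2 w)%:E (norm2 (S *m w))%:E
   <= efrac (r_sigma S Z w b eps x) (dist_boundary w b x))%E /\
  (efrac (r_sigma S Z w b eps x) (dist_boundary w b x)
   <= (Num.sqrt (1 / (1 - Num.sqrt (3 * eps))))%:E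
     * efrac (norm2 w)%:E (norm2 (S *m w))%:E)%E.
Proof.
have [trS _] := hS.
have nw := norm2_gt0 hw.
have F0 : 0 < `|linf w b x| by rewrite normr_gt0.
(* The distance is finite and positive, so dividing by it is multiplying by a positive real, even
   when [r] is [+oo]. *)
have fracE (r : \bar R) : efrac r (dist_boundary w b x) =
    (r * (norm2 w / `|linf w b x|)%:E)%E.
  rewrite dist_boundaryE// /efrac eqe mulf_eq0 invr_eq0 !gt_eqF//=.
  by rewrite inver mulf_eq0 invr_eq0 !gt_eqF//= invf_div.
have k0 : 0 < norm2 w / `|linf w b x| by rewrite divr_gt0.
(* Both bounds then carry the same positive factor as the ratio, and it cancels. *)
have boundE (c : R) : 0 < c -> (c%:E * efrac (norm2 w)%:E (norm2 (S *m w))%:E =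
    efrac (c * `|linf w b x|)%:E (norm2 (S *m w))%:E * (norm2 w / `|linf w b x|)%:E)%E.
  move=> c0; rewrite -efracM// [RHS]muleC -efracM//; congr (efrac _%:E _).
  by field; rewrite gt_eqF.
have L0 : 0 < Num.sqrt (1 / (2 * ln (1 / eps))).
  rewrite sqrtr_gt0 divr_gt0// mulr_gt0// ln_gt0// ltr_pdivlMr// mul1r.
  by apply: lt_trans heps1 _; lra.
have U0 : 0 < Num.sqrt (1 / (1 - Num.sqrt (3 * eps))).
  rewrite sqrtr_gt0 divr_gt0// subr_gt0 -[ltRHS]sqrtr1 ltr_sqrt//; lra.
rewrite fracE !boundE// !lee_pmul2r// ?lte_fin//.
split; last exact: r_sigma_le.
apply: r_sigma_ge => //; lra.
Qed.
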